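(* Let $f:X\to Y$ be a continuous map from a Čech-complete space $X$ to a functionally Hausdorff space $Y$. If $|f(X)|>\max\{\psi(Y),l(X)\}$, then there exists a compact subset $K\subset X$ whose image $f(K)$ is not scattered.
   Context: A topological space is scattered if every non-empty subspace of it contains an isolated point (of that subspace). A topological space $Y$ is functionally Hausdorff if for any distinct points $x,y\in Y$ there exists a continuous map $g:Y\to[0,1]$ with $g(x)=0$ and $g(y)=1$. A space is Čech-complete if it is Tychonoff and is a $G_\delta$-set in some (equivalently, any) of its compactifications. The Lindelöf number $l(X)$ of a topological space $X$ is the smallest infinite cardinal $\kappa$ such that any open cover of $X$ has a subcover of cardinality not exceeding $\kappa$. The pseudocharacter $\psi(Y)$ of a topological space $Y$ is the smallest cardinal $\kappa$ such that for any point $y\in Y$ the family $\tau_y$ of all open neighborhoods of $y$ contains a subfamily $\mathcal U_y\subset\tau_y$ of cardinality $|\mathcal U_y|\le\kappa$ with $\bigcap\mathcal U_y=\bigcap\tau_y$. *)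

(* Defs.v *)
From mathcomp Require Import all_boot all_order all_algebra.
From mathcomp Require Import all_classical all_reals all_analysis.
From mathcomp Require Import borel_hierarchy.

Set Implicit Arguments.
Unset Strict Implicit.
Unset Printing Implicit Defensive.

Import Order.TTheory GRing.Theory Num.Theory.
Import numFieldNormedType.Exports.

Open Scope classical_set_scope.
Open Scope ring_scope.
Open Scope card_scope.

(* Cardinals are represented by arbitrary sets [A : set S], with [S : Type],
   compared by injections ([#<=]) and bijections ([#=]). *)

Definition card_lt S T (A : set S) (B : set T) : bool :=
  (A #<= B) && (A #!= B).

Notation "A '#<' B" :=
  (card_lt A B) (at level 79, format "A  '#<'  B") : card_scope.

Definition card_max S T (A : set S) (B : set T) : set (S + T) :=
  if A #<= B then inr @` B else inl @` A.

Definition open_cover (X : topologicalType) (C : set (set X)) :=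
  C `<=` open /\ \bigcup_(U in C) U = setT.

Definition lindelof_le (X : topologicalType) T (K : set T) :=
  forall C : set (set X), open_cover C ->
    exists D : set (set X), [/\ D `<=` C, open_cover D & D #<= K].

Definition is_lindelof_number (X : topologicalType) T (K : set T) :=
  [/\ infinite_set K,
      lindelof_le X K &
      forall T' (K' : set T'),
        infinite_set K' -> lindelof_le X K' -> K #<= K'].

Definition pseudocharacter_le (Y : topologicalType) T (K : set T) :=
  forall y : Y, exists U_ : set (set Y),
    [/\ U_ `<=` open_nbhs y,
        U_ #<= K &
        \bigcap_(U in U_) U = \bigcap_(U in open_nbhs y) U].

Definition is_pseudocharacter (Y : topologicalType) T (K : set T) :=
  pseudocharacter_le Y K /\
  forall T' (K' : set T'), pseudocharacter_le Y K' -> K #<= K'.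

(* The isolated points of a subset of [A] are the same whether computed in [A]
   with the subspace topology or in [Y]. *)
Definition scattered (Y : topologicalType) (A : set Y) :=
  forall S : set Y, S `<=` A -> S !=set0 -> isolated S !=set0.

Definition functionally_hausdorff (R : realType) (Y : topologicalType) :=
  forall x y : Y, x <> y ->
    exists g : Y -> R,
      [/\ continuous g, range g `<=` `[0, 1], g x = 0 & g y = 1].

Definition tychonoff_space (X : topologicalType) :=
  accessible_space X /\ completely_regular_space X.

Definition topological_embedding (X Z : topologicalType) (e : X -> Z) :=
  injective e /\
  forall U : set X, open U <-> exists2 V : set Z, open V & e @^-1` V = U.

Definition is_compactification (X Z : topologicalType) (e : X -> Z) :=
  [/\ compact [set: Z], hausdorff_space Z,
      topological_embedding e & dense (range e)].

Definition cech_complete (X : topologicalType) :=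
  tychonoff_space X /\
  exists (Z : topologicalType) (e : X -> Z),
    is_compactification e /\ Gdelta (range e).

(* Main.v *)
Require Import Defs.
From mathcomp Require Import all_boot all_order all_algebra.
From mathcomp Require Import all_classical all_reals all_analysis.
From mathcomp Require Import borel_hierarchy.
Import numFieldNormedType.Exports.

Set Implicit Arguments.
Unset Strict Implicit.
Unset Printing Implicit Defensive.

(** Write kappa for max(psi(Y), l(X)) and call a subset of X heavy when its
    image under f has more than kappa points; X itself is heavy.  Since
    kappa * kappa = kappa ([card_le_square]), a union of kappa many sets that
    are not heavy is not heavy ([card_le_bigcup]), so by the Lindelof property
    a closed set that is locally not heavy is not heavy ([card_le_locally]).

    Let F be closed and heavy, and y a point of Y.  As y is an intersection of
    kappa many open sets, F minus the fibre of y is a union of kappa many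
    closed sets, so outside that fibre there is a point all of whose
    neighborhoods meet F in a heavy set ([heavy_point_avoiding]).  Using this
    twice yields two such points of F with distinct images; small closed
    neighborhoods of them cut out of F two closed heavy pieces with disjoint
    images ([heavy_split]).

    Iterating in a compactification Z of X, with X the intersection of open
    sets W_n, gives a binary tree of nonempty closed sets M_s of Z such that the
    sets of level n + 1 lie in W_n and siblings have images in Y that are
    disjoint ([heavy_tree]).  By Zorn's lemma and compactness there is a minimal
    closed set C of Z that meets every M_s.  Minimality places C in each level,
    hence in every W_n, hence in X: so C is a compact subset of X.  Its image
    has no isolated point: if an open set V met f(C) in the single point y, then
    C minus the preimage of V would be closed and smaller than C, so it would
    miss some M_s.  Then f would be constant on the part of C in M_s, although C
    meets both children of M_s ([tree_not_scattered]). *)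

(** * Comparison of cardinals *)

Local Open Scope classical_set_scope.

Lemma card_le_injP T U (A : set T) (B : set U) : B !=set0 ->
  A #<= B <-> exists2 f : T -> U, set_fun A B f & set_inj A f.
Proof.
elim/Ppointed: U => U in B *; first by move=> [x _]; case: (no x).
by move=> _; rewrite -injfunPex; split=> /pcard_leP.
Qed.

(** The injection need not be chosen by hand: a total relation whose converse is
    functional contains one.  This is the form in which the graphs produced by
    Zorn's lemma, and existential descriptions of a code, give comparisons. *)
Lemma card_le_rel T U (A : set T) (B : set U) (r : T -> U -> Prop) :
  (forall x, A x -> exists2 y, B y & r x y) ->
  (forall x x' y, A x -> A x' -> r x y -> r x' y -> x = x') ->
  A #<= B.
Proof.
move=> rtot rinj; have [->//|/set0P[a Aa]] := eqVneq A set0.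
have [b Bb _] := rtot a Aa.
have /boolp.choice[f fP] : forall x, exists y, A x -> B y /\ r x y.
  move=> x; have [Ax|nAx] := pselect (A x); last by exists b.
  by have [y By rxy] := rtot x Ax; exists y.
apply/card_le_injP; first by exists b.
exists f; first by move=> x /fP[].
move=> x x' /set_mem Ax /set_mem Ax' eqf.
have [_ rx] := fP x Ax; have [_ rx'] := fP x' Ax'.
by apply: rinj rx _ => //; rewrite eqf.
Qed.

(** Properties of graphs that constrain at most two of their elements at a time
    pass to unions of chains through this lemma. *)
Lemma total_subset_pair T (F : set (set T)) x y :
  total_on F subset -> (\bigcup_(G in F) G) x -> (\bigcup_(G in F) G) y ->
  exists G, [/\ F G, G x & G y].
Proof.
move=> Ftot [G FG Gx] [H FH Hy].
have [GH|HG] := Ftot _ _ FG FH; first by exists H; split=> //; apply: GH.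
by exists G; split=> //; apply: HG.
Qed.

(** Take a maximal graph of a partial bijection between [A] and [B].  If it
    misses both some [a] in [A] and some [b] in [B], adding [(a, b)] contradicts
    maximality; so it is defined on all of [A] or attains all of [B]. *)
Lemma card_le_total T U (A : set T) (B : set U) : A #<= B \/ B #<= A.
Proof.
pose P (G : set (T * U)) := G `<=` A `*` B /\
  forall p q, G p -> G q -> p.1 = q.1 <-> p.2 = q.2.
(* The equivalence says at once that the graph is functional and injective. *)
have [|G [[GAB Ginj] Gmax]] := @Zorn_bigcup _ P.
  move=> F FP Ftot; split; first by apply: bigcup_sub => G /FP[].
  move=> p q Fp Fq; have [G [FG Gp Gq]] := total_subset_pair Ftot Fp Fq.
  by have [_] := FP _ FG; apply.
have [dom|/existsNP[a /not_implyP[Aa nGa]]] :=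
  pselect (forall a, A a -> exists b, G (a, b)).
  left; apply: (@card_le_rel _ _ _ _ (fun a b => G (a, b))).
    move=> a Aa; have [b Gab] := dom a Aa.
    by exists b => //; have [] := GAB _ Gab.
  by move=> x x' y _ _ Gx Gx'; apply/(Ginj _ _ Gx Gx').
have [cod|/existsNP[b /not_implyP[Bb nGb]]] :=
  pselect (forall b, B b -> exists a, G (a, b)).
  right; apply: (@card_le_rel _ _ _ _ (fun b a => G (a, b))).
    move=> b Bb; have [a' Gab] := cod b Bb.
    by exists a' => //; have [] := GAB _ Gab.
  by move=> x x' y _ _ Gx Gx'; apply/(Ginj _ _ Gx Gx').
exfalso; apply: (Gmax ((a, b) |` G)).
  split; first by move=> p Gp; right.
  by move=> /(_ (a, b) (or_introl erefl)) Gab; apply: nGa; exists b.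
split; first by move=> p [->|/GAB].
move=> [p1 p2] [q1 q2] /=.
move=> [[-> ->]|Gp] [[-> ->]|Gq] //; last exact: (Ginj _ _ Gp Gq).
- split=> [ea|eb]; exfalso; first by apply: nGa; exists q2; rewrite ea.
  by apply: nGb; exists q1; rewrite eb.
- split=> [ea|eb]; exfalso; first by apply: nGa; exists p2; rewrite -ea.
  by apply: nGb; exists p1; rewrite -eb.
Qed.

Lemma card_le_setX T T' U U' (A : set T) (A' : set T')
    (B : set U) (B' : set U') :
  A #<= B -> A' #<= B' -> A `*` A' #<= B `*` B'.
Proof.
have [->|/set0P[a Aa]] := eqVneq A set0; first by rewrite set0X.
have [->|/set0P[a' Aa']] := eqVneq A' set0; first by rewrite setX0.
move=> AB AB'.
have B0 : B !=set0.
  by apply/set0P/eqP => B0; move: AB Aa; rewrite B0 => /card_le0P ->.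
have B'0 : B' !=set0.
  by apply/set0P/eqP => B'0; move: AB' Aa'; rewrite B'0 => /card_le0P ->.
move: AB AB' => /(card_le_injP _ B0)[f fAB finj].
move=> /(card_le_injP _ B'0)[g gAB ginj].
apply: (@card_le_rel _ _ _ _ (fun x y => y = (f x.1, g x.2))).
  move=> x [Ax Ax']; exists (f x.1, g x.2) => //.
  by split; [apply: fAB|apply: gAB].
move=> [x1 x2] [x1' x2'] _ [/= A1 A2] [/= A1' A2'] -> [/= e1 e2].
by congr pair; [apply: finj|apply: ginj]; rewrite ?inE.
Qed.

(** * The square of an infinite cardinal *)

(** The union embeds in two disjoint copies of [A], which live in [A `*` A] as
    the slices over two distinct points. *)
Lemma card_le_setU_square T V (C : set T) (D : set T) (A : set V) :
  infinite_set A -> A `*` A #<= A -> C #<= A -> D #<= A -> C `|` D #<= A.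
Proof.
move=> Ainf AA CA DA; have A0 := infinite_setN0 Ainf.
have [a0 Aa0] := A0.
have [a1 [Aa1 na1]] : exists a, A a /\ a <> a0.
  apply: contrapT => /forallNP H; apply: Ainf.
  apply: sub_finite_set (finite_set1 a0) => x Ax.
  by apply: contrapT => nx; apply: (H x).
apply: card_le_trans AA.
move: CA DA => /(card_le_injP _ A0)[f fAB finj].
move=> /(card_le_injP _ A0)[g gAB ginj].
apply: (@card_le_rel _ _ _ _ (fun x y =>
   C x /\ y = (f x, a0) \/ D x /\ y = (g x, a1))).
  move=> x [Cx|Dx].
    exists (f x, a0); last by left.
    by split=> //; apply: fAB.
  exists (g x, a1); last by right.
  by split=> //; apply: gAB.
move=> x x' y _ _ [[Cx ->]|[Dx ->]] [[Cx' []]|[Dx' []]].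
- by move=> /finj; apply; rewrite inE.
- by move=> _ /esym.
- by [].
- by move=> /ginj; apply; rewrite inE.
Qed.

(** For [square_injection G] as defined below, [square_base G] is the set [A]
    for which [G] is the graph of an injection of [A `*` A] into [A].  Reading
    [A] off the diagonal of [G] makes an ordering by inclusion of the graphs
    alone suffice in Zorn's lemma. *)
Definition square_base T (G : set ((T * T) * T)) : set T :=
  [set a | exists c, G ((a, a), c)].

Definition square_injection T (G : set ((T * T) * T)) :=
  let A := square_base G in
  [/\ forall p q, G p -> G q -> p.1 = q.1 <-> p.2 = q.2,
      forall a b, A a -> A b -> exists c, G ((a, b), c) &
      forall a b c, G ((a, b), c) -> [/\ A a, A b & A c]].

Lemma square_injection_card T (G : set ((T * T) * T)) : square_injection G ->
  square_base G `*` square_base G #<= square_base G.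
Proof.
move=> [Ginj Gtot GA].
apply: (@card_le_rel _ _ _ _ (fun x y => G (x, y))).
  move=> [a b] [/= Aa Ab]; have [c Gc] := Gtot a b Aa Ab.
  by exists c => //; have [] := GA _ _ _ Gc.
by move=> x x' y _ _ Gx Gx'; apply/(Ginj _ _ Gx Gx').
Qed.

(** The pairs over the enlarged base that are not pairs over the old base are
    sent into the new part [B], so they cannot collide with old values. *)
Lemma square_injection_extend T (G : set ((T * T) * T)) (B : set T) :
  square_injection G -> B !=set0 -> B `&` square_base G = set0 ->
  (square_base G `|` B) `*` (square_base G `|` B) #<= B ->
  exists G', [/\ square_injection G', G `<` G' &
    square_base G' = square_base G `|` B].
Proof.
set A := square_base G => -[Ginj Gtot GA] B0 BA.
have nAB x : B x -> ~ A x by move=> Bx Ax; have : set0 x by rewrite -BA.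
move=> /(card_le_injP _ B0)[h hB hinj].
pose D := ((A `|` B) `*` (A `|` B)) `\` (A `*` A).
pose G' : set ((T * T) * T) := G `|` [set p | D p.1 /\ p.2 = h p.1].
have GD p : G p -> ~ D p.1.
  by case: p => -[a b] c /GA[Aa Ab _] [_ /=]; apply.
have baseG' : square_base G' = A `|` B.
  apply/seteqP; split=> [a [c [Gc|[[[/= ABa _] _] _]]]//|a [[c Gc]|Ba]].
  - by have [] := GA _ _ _ Gc; left.
  - by exists c; left.
  - by exists (h (a, a)); right; split=> //; split=> /=;
      [split; right|move=> -[/= /(nAB _ Ba)]].
exists G'; split=> //; last first.
  split; first by move=> p; left.
  have [b Bb] := B0; move=> /(_ ((b, b), h (b, b))) GG'.
  have Gb : G ((b, b), h (b, b)).
    apply: GG'; right; split=> //.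
    by split; [split; right|move=> -[/= /(nAB _ Bb)]].
  by apply: (nAB _ Bb); exists (h (b, b)).
rewrite /square_injection baseG'; split.
- move=> p q [Gp|[Dp ep]] [Gq|[Dq eq]].
  + exact: Ginj.
  + split=> [e|e]; first by case: (GD _ Gp); rewrite e.
    case: p Gp e => -[a b] c /GA[_ _ Ac] /= e; case: (nAB c) => //.
    by rewrite e eq; apply: hB; case: Dq.
  + split=> [e|e]; first by case: (GD _ Gq); rewrite -e.
    case: q Gq e => -[a b] c /GA[_ _ Ac] /= e; case: (nAB c) => //.
    by rewrite -e ep; apply: hB; case: Dp.
  + rewrite ep eq; split=> [->//|]; apply: hinj; rewrite inE.
      by case: Dp.
    by case: Dq.
- move=> a b ABa ABb; have [[Aa Ab]|nAA] := pselect (A a /\ A b).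
    by have [c Gc] := Gtot a b Aa Ab; exists c; left.
  by exists (h (a, b)); right.
- move=> a b c [/GA[Aa Ab Ac]|[[[/= ABa ABb] _] ->]]; first by split; left.
  by split=> //; right; apply: hB.
Qed.

(** Take an injection [A `*` A -> A] with [A `<=` K] that is maximal.  It cannot
    be extended to a larger base inside [K].  A finite [A] would be extended by
    a countably infinite part of [K `\` A].  If [A] is infinite and [K `\` A] is
    at least as large, a copy of [A] in [K `\` A] extends it; so [K `\` A] is at
    most as large as [A], and then so is [K]. *)
Lemma card_le_square T (K : set T) : infinite_set K -> K `*` K #<= K.
Proof.
move=> Kinf.
pose P G := square_injection G /\ square_base G `<=` K.
have [|G [[Gsq GK] Gmax]] := @Zorn_bigcup _ P.
  move=> F FP Ftot; pose W := \bigcup_(G in F) G.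
  have baseW G a : F G -> square_base G a -> square_base W a.
    by move=> FG [c Gc]; exists c, G.
  split; last by move=> a [c [G FG Gc]]; have [_] := FP _ FG; apply; exists c.
  split.
  - move=> p q Wp Wq; have [G [FG Gp Gq]] := total_subset_pair Ftot Wp Wq.
    by have [[+ _ _] _] := FP _ FG; apply.
  - move=> a b [c Wa] [d Wb].
    have [G [FG Ga Gb]] := total_subset_pair Ftot Wa Wb.
    have [[_ Gtot _] _] := FP _ FG.
    have [||e Ge] := Gtot a b; [by exists c|by exists d|by exists e, G].
  - move=> a b c [G FG Gab]; have [[_ _ /(_ _ _ _ Gab)[Ga Gb Gc]] _] := FP _ FG.
    by split; apply: (baseW G).
set A := square_base G in GK.
have noext B : B `<=` K `\` A -> B !=set0 ->
    (A `|` B) `*` (A `|` B) #<= B -> False.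
  move=> BKA B0 Bsq.
  have [|G' [G'sq GG' baseG']] := square_injection_extend Gsq B0 _ Bsq.
    by apply/seteqP; split=> // x [/BKA[_]].
  apply: (Gmax _ GG'); split=> //; rewrite baseG'.
  by move=> x [/GK//|/BKA[]].
have AA : A `*` A #<= A by apply: square_injection_card.
have [Afin|Ainf] := pselect (finite_set A).
  have /infiniteP/card_subP[B BN BKA] := infinite_setD Kinf Afin.
  have Binf : infinite_set B by apply/infiniteP; rewrite (card_le_eqr BN).
  exfalso; apply: (noext B BKA); first exact: infinite_setN0.
  rewrite (card_le_eqr BN) -/(countable _).
  have ABc : countable (A `|` B).
    apply: card_le_setU_square; [exact: infinite_nat|exact: countableP| |].
      exact: finite_set_countable.
    by rewrite (card_le_eql BN).
  exact: countableX.
have KDA : K `\` A #<= A.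
  have [//|/card_subP[B BA BKA]] := card_le_total (K `\` A) A.
  exfalso; apply: (noext B BKA).
    by apply: infinite_setN0; rewrite -(eq_finite_set BA) in Ainf.
  rewrite (card_le_eqr BA); apply: (card_le_trans _ AA).
  have ABA : A `|` B #<= A.
    by apply: card_le_setU_square => //; rewrite (card_le_eql BA).
  exact: card_le_setX.
have KA : K #<= A.
  rewrite -(setUIDK K A); apply: card_le_setU_square => //.
  by apply: subset_card_le => x [].
apply: card_le_trans (card_le_setX KA KA) _.
exact: card_le_trans AA (subset_card_le GK).
Qed.

(** A point of the union is coded by an index of a member containing it and its
    code in that member. *)
Lemma card_le_bigcup I T U (D : set I) (F : I -> set T) (K : set U) :
  infinite_set K -> D #<= K -> (forall i, D i -> F i #<= K) ->
  \bigcup_(i in D) F i #<= K.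
Proof.
move=> Kinf DK FK; have K0 := infinite_setN0 Kinf.
apply: card_le_trans (card_le_square Kinf).
move: DK => /(card_le_injP _ K0)[h hD hinj].
have /boolp.choice[g gP] : forall i, exists g : T -> U, D i ->
    set_fun (F i) K g /\ set_inj (F i) g.
  move=> i; have [Di|nDi] := pselect (D i); last first.
    by have [k _] := K0; exists (fun=> k).
  by have /(card_le_injP _ K0)[g ? ?] := FK i Di; exists g.
apply: (@card_le_rel _ _ _ _ (fun x y =>
  exists i, [/\ D i, F i x & y = (h i, g i x)])).
  move=> x [i Di Fx]; exists (h i, g i x); last by exists i.
  by split; [apply: hD|have [+ _] := gP i Di; apply].
move=> x x' y _ _ [i [Di Fx ->]] [j [Dj Fx' [/hinj]]].
rewrite !inE => /(_ Di Dj) eij; rewrite -{}eij {j} in Dj Fx' * => /(gP i Di).2.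
by apply; rewrite inE.
Qed.

(** * Cardinal functions and separation *)

Lemma lindelof_leS (X : topologicalType) T U (A : set T) (K : set U) :
  A #<= K -> lindelof_le X A -> lindelof_le X K.
Proof.
move=> AK XA C /XA[D [DC Dcov DA]]; exists D; split=> //.
exact: card_le_trans AK.
Qed.

Lemma pseudocharacter_leS (Y : topologicalType) T U (A : set T) (K : set U) :
  A #<= K -> pseudocharacter_le Y A -> pseudocharacter_le Y K.
Proof.
move=> AK YA y; have [D [Dopen DA Dcap]] := YA y; exists D; split=> //.
exact: card_le_trans AK.
Qed.

Lemma card_max_geP S T (A : set S) (B : set T) :
  A #<= card_max A B /\ B #<= card_max A B.
Proof.
have inlA : (inl @` A : set (S + T)) #= A by apply: inj_card_eq => x y _ _ [].
have inrB : (inr @` B : set (S + T)) #= B by apply: inj_card_eq => x y _ _ [].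
rewrite /card_max; case: ifPn => [AB|nAB].
  by rewrite !(card_le_eqr inrB).
rewrite !(card_le_eqr inlA); split=> //.
by have [AB|//] := card_le_total A B; rewrite AB in nAB.
Qed.

Lemma functionally_hausdorff_hausdorff (R : realType) (Y : topologicalType) :
  functionally_hausdorff R Y -> hausdorff_space Y.
Proof.
move=> fH p q pq; apply: contrapT => /fH[g [gC _ gp gq]].
have : g p = g q.
  apply: (@norm_hausdorff R R^o) => A B Ap Bq.
  have [y [Ay By]] := pq _ _ (gC p A Ap) (gC q B Bq).
  by exists (g y).
by rewrite gp gq => /esym/eqP; rewrite GRing.oner_eq0.
Qed.

(** Cover [E] by open sets whose traces on [E] have small image, together with
    the complement of [E], whose trace is empty; the Lindelof property leaves
    few of them. *)
Lemma card_le_locally (X Y : topologicalType) (f : X -> Y) U (K : set U)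
    (E : set X) :
  infinite_set K -> lindelof_le X K -> closed E ->
  (forall x, E x -> exists V, [/\ open V, V x & f @` (E `&` V) #<= K]) ->
  f @` E #<= K.
Proof.
move=> Kinf XK Ecl Eloc.
have [|D [DC [_ Dcov] DK]] := XK [set V | open V /\ f @` (E `&` V) #<= K].
  split; first by move=> V [].
  apply/seteqP; split=> // x _; have [Ex|nEx] := pselect (E x).
    by have [V [? ? ?]] := Eloc x Ex; exists V.
  exists (~` E) => //; split; first exact: closed_openC.
  by rewrite setICr image_set0.
apply: card_le_trans (card_le_bigcup Kinf DK (F := fun V => f @` (E `&` V)) _).
  apply: subset_card_le => _ [x Ex <-].
  have [V DV Vx] : (\bigcup_(V in D) V) x by rewrite Dcov.
  by exists V => //; exists x.
by move=> V /DC[].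
Qed.

(** * Heavy sets *)

Definition heavy (X Y : topologicalType) (f : X -> Y) U (K : set U)
    (F : set X) :=
  ~ (f @` F #<= K).

Lemma heavyS (X Y : topologicalType) (f : X -> Y) U (K : set U) (F G : set X) :
  F `<=` G -> heavy f K F -> heavy f K G.
Proof.
move=> FG Fheavy GK; apply: Fheavy; apply: card_le_trans GK.
exact/subset_card_le/image_subset.
Qed.

(** The fibre of [y] is an intersection of few open sets, so the rest of [F] is
    a union of few closed sets.  If every point of that rest had a neighborhood
    with small trace on [F], each of these closed sets would have a small image,
    and so would [F]. *)
Lemma heavy_point_avoiding (X Y : topologicalType) (f : X -> Y) U
    (K : set U) (F : set X) (y : Y) :
  continuous f -> hausdorff_space Y ->
  infinite_set K -> lindelof_le X K -> pseudocharacter_le Y K ->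
  closed F -> heavy f K F ->
  exists x, f x <> y /\
    forall V, open V -> V x -> heavy f K (F `&` V).
Proof.
move=> fC YH Kinf XK YK Fcl Fheavy; apply: contrapT => Hno; apply: Fheavy.
have [D [Dopen DK Dcap]] := YK y.
have yK : [set y] #<= K.
  by apply: card_le_trans (finite_set_countable _) (iffLR (infiniteP _) Kinf).
(* For open [V] around [y], the part of [F] mapped outside [V] is closed and
   misses the fibre of [y]. *)
have FDK : \bigcup_(V in D) (f @` (F `&` f @^-1` (~` V))) #<= K.
  apply: card_le_bigcup => // V /Dopen[Vopen Vy].
  apply: card_le_locally => //.
    apply: closedI => //; apply: closed_comp => [x _|]; first exact: fC.
    exact: open_closedC.
  move=> x [Fx nVfx]; apply: contrapT => Hx; apply: Hno; exists x.
  split=> [efx|V' V'open V'x V'K]; first by apply: nVfx; rewrite /= efx.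
  apply: Hx; exists V'; split=> //; apply: card_le_trans V'K.
  by apply: subset_card_le; apply: image_subset => z [[]].
apply: card_le_trans
  (card_le_setU_square Kinf (card_le_square Kinf) yK FDK).
apply: subset_card_le => _ [x Fx <-].
have [->|fxy] := eqVneq (f x) y; first by left.
right.
(* In a Hausdorff space the open neighborhoods of [y] intersect in [y] only. *)
have : ~ (\bigcap_(V in D) V) (f x).
  rewrite Dcap => fxcap; move/eqP: fxy; apply; apply: YH => A B fxA yB.
  exists (f x); split; first exact: nbhs_singleton.
  have [V yV VB] : exists2 V, open_nbhs y V & V `<=` B.
    by move: yB; rewrite nbhsE.
  exact: (VB _ (fxcap _ yV)).
move=> /existsNP[V /not_implyP[DV nVfx]].
by exists V => //; exists x.
Qed.

(* the embedding *)
(** The shrinking takes place in [Z]: a closed neighborhood of [e x] inside [W]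
    keeps the whole limit set, not only its trace on [X], inside [W].  That is
    what eventually confines the limit of the tree to [X]. *)
Lemma heavy_shrink (X Y Z : topologicalType) (f : X -> Y) (e : X -> Z) U
    (K : set U) (M W : set Z) (x : X) (V : set Y) :
  continuous f -> compact [set: Z] -> hausdorff_space Z ->
  topological_embedding e -> open W -> range e `<=` W -> closed M ->
  (forall O, open O -> O x -> heavy f K (e @^-1` M `&` O)) ->
  open V -> V (f x) ->
  exists N, [/\ closed N, N `<=` M `&` W, heavy f K (e @^-1` N) &
    e @^-1` N `<=` f @^-1` V].
Proof.
move=> fC Zc ZH [_ eop] Wopen eW Mcl Mx Vopen Vfx.
have /eop[Q Qopen eQ] : open (f @^-1` V).
  by apply: open_comp => // z _; apply: fC.
have : nbhs (e x) (Q `&` W).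
  apply: open_nbhs_nbhs; split; first exact: openI.
  by split; [rewrite -[Q _]/((e @^-1` Q) x) eQ|apply: eW; exists x].
move=> /(compact_regular ZH Zc (@filterT _ (nbhs (e x)) _))[A Ax AQW].
exists (M `&` closure A); split.
- by apply: closedI => //; apply: closed_closure.
- by move=> z [Mz /AQW[_ Wz]].
- apply: heavyS (Mx (e @^-1` A^°) _ _).
  + by move=> z [Mz /interior_subset Az]; split=> //; apply: subset_closure.
  + by apply/eop; exists A^° => //; apply: open_interior.
  + exact: Ax.
- by rewrite -eQ => z [_ /AQW[]].
Qed.

(** The first point is only required to avoid an arbitrary fibre; the second one
    avoids the fibre of the first, so that their images can be separated. *)
Lemma heavy_split (X Y Z : topologicalType) (f : X -> Y) (e : X -> Z) U
    (K : set U) (W M : set Z) :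
  continuous f -> hausdorff_space Y -> compact [set: Z] -> hausdorff_space Z ->
  topological_embedding e ->
  infinite_set K -> lindelof_le X K -> pseudocharacter_le Y K ->
  open W -> range e `<=` W -> closed M -> heavy f K (e @^-1` M) ->
  exists N : bool -> set Z,
    (forall b, [/\ closed (N b), heavy f K (e @^-1` N b) & N b `<=` M `&` W]) /\
    (forall x x', N true (e x) -> N false (e x') -> f x <> f x').
Proof.
move=> fC YH Zc ZH emb Kinf XK YK Wopen eW Mcl Mheavy.
have FC : closed (e @^-1` M).
  rewrite -[M]setCK preimage_setC; apply: open_closedC.
  by apply/emb.2; exists (~` M) => //; apply: closed_openC.
have heavyP y := heavy_point_avoiding y fC YH Kinf XK YK FC Mheavy.
have [x0 Mx0] : e @^-1` M !=set0.
  by apply/set0P/eqP => M0; apply: Mheavy; rewrite M0 image_set0.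
have [x [_ xheavy]] := heavyP (f x0).
have [x' [/eqP xx' x'heavy]] := heavyP (f x).
move: YH; rewrite open_hausdorff => /(_ _ _ xx')[[V' V] /=].
rewrite !inE => -[V'x Vx] [V'open Vopen V'V0].
have [N [Ncl NMW Nheavy NV]] :=
  heavy_shrink fC Zc ZH emb Wopen eW Mcl xheavy Vopen Vx.
have [N' [N'cl N'MW N'heavy N'V]] :=
  heavy_shrink fC Zc ZH emb Wopen eW Mcl x'heavy V'open V'x.
exists (fun b => if b then N else N'); split; first by case.
move=> z z' /NV Vz /N'V V'z' ff; have : set0 (f z); last by [].
by rewrite -V'V0; split=> //; rewrite ff.
Qed.

(** A node is a list of turns with the latest one at its head, so that extending
    a node is [cons], and a node of length [n] has its children inside [W n]. *)
Lemma heavy_tree (X Y Z : topologicalType) (f : X -> Y) (e : X -> Z) U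
    (K : set U) (W : nat -> set Z) :
  continuous f -> hausdorff_space Y -> compact [set: Z] -> hausdorff_space Z ->
  topological_embedding e ->
  infinite_set K -> lindelof_le X K -> pseudocharacter_le Y K ->
  (forall n, open (W n)) -> (forall n, range e `<=` W n) ->
  heavy f K [set: X] ->
  exists M : seq bool -> set Z, forall s,
    [/\ closed (M s), M s !=set0,
        forall b, M (b :: s) `<=` M s `&` W (size s) &
        forall x x', M (true :: s) (e x) -> M (false :: s) (e x') ->
          f x <> f x'].
Proof.
move=> fC YH Zc ZH emb Kinf XK YK Wopen eW Xheavy.
have /boolp.choice[N NP] : forall p : nat * set Z, exists N : bool -> set Z,
    closed p.2 -> heavy f K (e @^-1` p.2) ->
    (forall b, [/\ closed (N b), heavy f K (e @^-1` N b) &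
                   N b `<=` p.2 `&` W p.1]) /\
    (forall x x', N true (e x) -> N false (e x') -> f x <> f x').
  (* The pair carries the level [n], which selects the open set [W n]. *)
  move=> [n M] /=; have [[Mcl Mheavy]|nM] :=
    pselect (closed M /\ heavy f K (e @^-1` M)); last first.
    by exists (fun=> set0) => Mcl Mheavy; case: nM.
  have [N NP] :=
    heavy_split fC YH Zc ZH emb Kinf XK YK (Wopen n) (eW n) Mcl Mheavy.
  by exists N.
pose M := fix M (s : seq bool) : set Z :=
  if s is b :: s' then N (size s', M s') b else setT.
have MP s : closed (M s) /\ heavy f K (e @^-1` M s).
  elim: s => [|b s [Mcl Mheavy]] /=.
    by rewrite preimage_setT; split=> //; exact: closedT.
  by have [/(_ b)[]] := NP (size s, M s) Mcl Mheavy.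
exists M => s; have [Mcl Mheavy] := MP s.
have [Nb Ndisj] := NP (size s, M s) Mcl Mheavy.
split=> //; last by move=> b; have [] := Nb b.
apply/set0P/eqP => M0; apply: Mheavy.
by rewrite M0 preimage_set0 image_set0.
Qed.

(** * Compactness *)

(** Zorn's lemma is applied to complements, where decreasing chains of closed
    sets become increasing chains of open sets.  The intersection of a chain
    still meets each [M i], since in a compact space the traces on [M i] of its
    members generate a filter, which has a cluster point. *)
Lemma exists_minimal_closed_transversal (Z : topologicalType) I
    (M : I -> set Z) :
  compact [set: Z] -> (forall i, closed (M i)) -> (forall i, M i !=set0) ->
  exists C, [/\ closed C, forall i, C `&` M i !=set0 &
    forall C', closed C' -> C' `<=` C -> (forall i, C' `&` M i !=set0) ->
      C' = C].
Proof.
move=> Zc Mcl M0.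
pose P (A : set Z) := open A /\ forall i, ~` A `&` M i !=set0.
have [|A [[Aopen AM] Amax]] := @Zorn_bigcup _ P.
  move=> F FP Ftot; split; first by apply: bigcup_open => A /FP[].
  move=> i; have [->|/set0P[A0 FA0]] := eqVneq F set0.
    by rewrite bigcup_set0 setC0 setTI.
  pose G := filter_from F (fun A => M i `\` A).
  have GF : ProperFilter G.
    apply: filter_from_proper; last first.
      by move=> A /FP[_ /(_ i)]; rewrite setIC.
    apply: filter_from_filter; first by exists A0.
    move=> A B FA FB; have [AB|BA] := Ftot _ _ FA FB.
      by exists B => // z [Mz nBz]; split; split=> // /AB.
    by exists A => // z [Mz nAz]; split; split=> // /BA.
  have [|p [Mp Gp]] := subclosed_compact (Mcl i) Zc (@subsetT _ _) GF.
    by exists A0 => // z [].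
  exists p; split=> // -[A FA Ap].
  have [||z [[_ nAz] Az]//] := Gp (M i `\` A) A; first by exists A.
  by apply: open_nbhs_nbhs; split=> //; have [] := FP _ FA.
exists (~` A); split=> //; first exact: open_closedC.
move=> C' C'cl C'A C'M; apply/seteqP; split=> //; apply: contrapT => AC'.
apply: (Amax (~` C')); last first.
  by split; [exact: closed_openC|move=> i; rewrite setCK].
split; first by move=> z Az /C'A; apply.
by move=> C'subA; apply: AC' => z nAz; apply: contrapT => /C'subA.
Qed.

Lemma embedding_compact_preimage (X Z : topologicalType) (e : X -> Z) C :
  topological_embedding e -> compact C -> C `<=` range e ->
  compact (e @^-1` C).
Proof.
move=> [_ eop] Cc Ce F FF FC.
have [z [Cz clz]] := Cc (e @ F) _ FC.
have [x _ exz] := Ce _ Cz; exists x; split; first by rewrite /= exz.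
move=> A B FA; rewrite nbhsE => -[B' [/eop[V Vopen VB'] B'x] B'B].
have [||_ [[t At <-] Vt]] := clz (e @` A) V.
- by apply: (@filterS _ F _ A) => // t At; exists t.
- by apply: open_nbhs_nbhs; split=> //; rewrite -exz -[V _]/((e @^-1` V) x) VB'.
- by exists t; split=> //; apply: B'B; rewrite -VB'.
Qed.

Lemma finite_size_set (T : finType) n : finite_set [set s : seq T | size s = n].
Proof.
apply: (@sub_finite_set _ _ ((fun t : n.-tuple T => tval t) @` setT)).
  by move=> s /= sn; exists (tcast sn (in_tuple s)) => //; rewrite val_tcast.
exact/finite_image/finite_finset.
Qed.

(** * From a tree to a non-scattered image *)

(** Let [C] be a minimal closed set meeting all [M s].  It lies in [range e]
    because its intersection with the union of the [M s] of one level still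
    meets every node, hence equals [C].  An isolated point of the image of [C]
    would allow [C] to shrink, unless the image of [C] were a single point below
    some node, which the children of that node prevent. *)
Lemma tree_not_scattered (X Y Z : topologicalType) (f : X -> Y) (e : X -> Z)
    (W : nat -> set Z) (M : seq bool -> set Z) :
  continuous f -> compact [set: Z] -> topological_embedding e ->
  \bigcap_n W n = range e ->
  (forall s, [/\ closed (M s), M s !=set0,
        forall b, M (b :: s) `<=` M s `&` W (size s) &
        forall x x', M (true :: s) (e x) -> M (false :: s) (e x') ->
          f x <> f x']) ->
  exists K : set X, compact K /\ ~ scattered (f @` K).
Proof.
move=> fC Zc emb We MP.
have Mcl s : closed (M s) by have [] := MP s.
have [C [Ccl CM Cmin]] := exists_minimal_closed_transversal Zc Mcl
  (fun s => let: And4 _ M0 _ _ := MP s in M0).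
have Mcat u s : M (u ++ s) `<=` M s.
  by elim: u => //= b u IH z; have [_ _ /(_ b z) MW _ /MW[/IH]] := MP (u ++ s).
have CW n : C `<=` W n.
  pose L := \bigcup_(s in [set s | size s = n.+1]) M s.
  have LW : L `<=` W n.
    by move=> z [[//|b s] [<-]]; have [_ _ MW _ /MW[]] := MP s.
  apply: subset_trans LW; suff <- : C `&` L = C by apply: subIsetr.
  apply: Cmin => [|z []//|t].
    apply: closedI => //; apply: closed_bigcup => //.
    exact: finite_size_set.
  (* A node above level [n.+1] is replaced by a descendant on that level, a
     deeper one by its ancestor there. *)
  have [tn|nt] := leqP (size t) n.+1.
    have [z [Cz Mz]] := CM (nseq (n.+1 - size t) false ++ t).
    exists z; split; last exact: Mcat Mz.
    split=> //; exists (nseq (n.+1 - size t) false ++ t) => //=.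
    by rewrite size_cat size_nseq subnK.
  have [z [Cz Mz]] := CM t; exists z; split=> //; split=> //.
  exists (drop (size t - n.+1) t) => /=.
    by rewrite size_drop subKn // ltnW.
  by move: Mz; rewrite -{1}(cat_take_drop (size t - n.+1) t); apply: Mcat.
have Ce : C `<=` range e by rewrite -We => z Cz n _; apply: CW.
exists (e @^-1` C); split.
  apply: embedding_compact_preimage => //.
  exact: subclosed_compact Ccl Zc _.
move=> /(_ _ (@subset_refl _ _)) [].
  have [z [Cz _]] := CM [::]; have [x _ exz] := Ce z Cz.
  by exists (f x), x => //; rewrite /= exz.
move=> y [/set_mem[x0 Cx0 fx0] [V yV Vy]].
have [_ eop] := emb.
have /eop[Q Qopen eQ] : open (f @^-1` V^°).
  by apply: open_comp => [z _|]; [exact: fC|exact: open_interior].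
(* [Q] is the open set of [Z] induced by a neighborhood isolating [y]; removing
   it from [C] must lose some node [s]. *)
have [C'M|/existsNP[s nC's]] := pselect (forall s, (C `&` ~` Q) `&` M s !=set0).
  have C'C : C `&` ~` Q = C.
    by apply: Cmin => //; apply: closedI => //; exact: open_closedC.
  have [_ ] : (C `&` ~` Q) (e x0) by rewrite C'C.
  apply; rewrite -[Q _]/((e @^-1` Q) x0) eQ /= fx0; exact: yV.
have fy b : exists x, M (b :: s) (e x) /\ f x = y.
  have [z [Cz Mz]] := CM (b :: s); have [x _ exz] := Ce z Cz.
  exists x; split; first by rewrite exz.
  have Qz : Q z.
    apply: contrapT => nQz; apply: nC's; exists z; split=> //.
    by have [_ _ /(_ b z Mz)[]] := MP s.
  have Vfx : V (f x).
    by apply: interior_subset; rewrite -[_ (f x)]/((f @^-1` V^°) x) -eQ /= exz.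
  have : (V `&` f @` (e @^-1` C)) (f x).
    by split=> //; exists x => //; rewrite /= exz.
  by rewrite Vy.
have [x [Mx fx]] := fy true; have [x' [Mx' fx']] := fy false.
have [_ _ _ /(_ x x' Mx Mx')] := MP s; apply.
by rewrite fx fx'.
Qed.

Theorem theorem2 (R : realType) (X Y : topologicalType) (f : X -> Y)
    (S T : Type) (psiY : set S) (lX : set T) :
  continuous f ->
  cech_complete X ->
  functionally_hausdorff R Y ->
  is_pseudocharacter Y psiY ->
  is_lindelof_number X lX ->
  card_max psiY lX #< range f ->
  exists K : set X, compact K /\ ~ scattered (f @` K).
Proof.
move=> fC [_ [Z [e [[Zc ZH emb _] [W Wopen We]]]]] YfH [Ypsi _] [lXinf Xl _].
move=> /andP[fbig fne].
have [psiK lK] := card_max_geP psiY lX.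
set K := card_max psiY lX in fbig fne psiK lK.
have eW n : range e `<=` W n by rewrite We => z; apply.
have Kinf : infinite_set K.
  by apply/infiniteP; apply: card_le_trans lK; apply/infiniteP.
have fheavy : heavy f K [set: X].
  by move=> fK; move/negP: fne; apply; rewrite card_eq_le fbig.
have [M MP] := heavy_tree fC (functionally_hausdorff_hausdorff YfH) Zc ZH emb
  Kinf (lindelof_leS lK Xl) (pseudocharacter_leS psiK Ypsi) Wopen eW fheavy.
exact: (tree_not_scattered fC Zc emb (esym We) MP).
Qed.
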